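(* For $p\in\{11,12,21\}$ let $G_p(x,y)$ be the bivariate generating function in which the coefficient of $x^ny^k$ ($n\ge0$, $k\ge1$) is the popularity of the consecutive pattern $p$ in the set $\mathcal{S}_{n,k}$ of $k$-ary faro words of length $n$, i.e. the total number of occurrences of $p$ over all words in $\mathcal{S}_{n,k}$. Then $$G_{11}(x,y)=\frac{4x^2y}{(1-y-2x+x^2+A_1)^2},$$ $$G_{21}(x,y)=\frac{2x^2y\,(1+y-x^2-A_1)}{(1-y-2x+x^2+A_1)^2A_1},$$ $$G_{12}(x,y)=\frac{2xy\left(A_3+(x^3-2x^2+2xy-2x-2y+2)A_1\right)}{(1-y-2x+x^2+A_1)^2(1-y)A_1},$$ where $A_1=\sqrt{x^4-2x^2y-2x^2+y^2-2y+1}$ and $A_3=x^5-2x^4-x^3y-3x^3+4x^2y+4x^2-2xy-2y^2+2x+4y-2$.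
   Context: A $k$-ary word is a word over $\{1,\dots,k\}$. A $k$-ary faro word of length $n$ is a word $u_1v_1u_2v_2u_3v_3\cdots$ of length $n=|u|+|v|$ obtained by interlacing two nondecreasing $k$-ary words $u,v$ with $0\le |u|-|v|\le 1$ (equivalently, $w_i\le w_{i+2}$ for all $1\le i\le n-2$). Occurrences of $11$, $12$, $21$ in a word $w$ are indices $i$ with $w_i=w_{i+1}$, $w_i<w_{i+1}$, $w_i>w_{i+1}$, respectively. Generating functions are formal power series, and square roots denote the branch with constant term $1$. *)

(* Defs.v *)
From HB Require Import structures.
From mathcomp Require Import all_boot all_order all_algebra.
From mathcomp Require Import boolp classical_sets.

Set Implicit Arguments.
Unset Strict Implicit.
Unset Printing Implicit Defensive.

Import GRing.Theory.
Local Open Scope ring_scope.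

(* A record rather than a bare [nat -> R], which already carries the pointwise
   product. *)
Record fps (R : Type) := Fps { coefs : nat -> R }.

Lemma fpsP (R : Type) (f g : fps R) : coefs f =1 coefs g -> f = g.
Proof. by case: f g => [f] [g] /= /funext ->. Qed.

HB.instance Definition _ (R : Type) := gen_eqMixin (fps R).
HB.instance Definition _ (R : Type) := gen_choiceMixin (fps R).

Section FpsRing.
Variable R : comUnitRingType.
Implicit Types f g h : fps R.

Definition fps_add f g := Fps (fun n => coefs f n + coefs g n).
Definition fps_opp f := Fps (fun n => - coefs f n).
Definition fps_mul f g :=
  Fps (fun n => \sum_(i < n.+1) coefs f i * coefs g (n - i)).
Definition fpsC (c : R) := Fps (fun n => if n == 0%N then c else 0).
Definition fpsX : fps R := Fps (fun n => if n == 1%N then 1 else 0).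

Lemma fps_addA : associative fps_add.
Proof. by move=> f g h; apply: fpsP => n /=; rewrite addrA. Qed.
Lemma fps_addC : commutative fps_add.
Proof. by move=> f g; apply: fpsP => n /=; rewrite addrC. Qed.
Lemma fps_add0 : left_id (fpsC 0) fps_add.
Proof. by move=> f; apply: fpsP => n /=; rewrite if_same add0r. Qed.
Lemma fps_addN : left_inverse (fpsC 0) fps_opp fps_add.
Proof. by move=> f; apply: fpsP => n /=; rewrite addNr if_same. Qed.

HB.instance Definition _ :=
  GRing.isZmodule.Build (fps R) fps_addA fps_addC fps_add0 fps_addN.

Let trunc N f : {poly R} := \poly_(i < N.+1) coefs f i.

Lemma coefs_mul_trunc N f g n : (n <= N)%N ->
  coefs (fps_mul f g) n = (trunc N f * trunc N g)`_n.
Proof.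
move=> le_nN; rewrite coefM /=; apply: eq_bigr => i _.
have le_in : (i <= n)%N by rewrite -ltnS.
by rewrite !coef_poly !ltnS (leq_trans le_in le_nN) (leq_trans (leq_subr _ _) le_nN).
Qed.

Lemma fps_mulC : commutative fps_mul.
Proof.
by move=> f g; apply: fpsP => n; rewrite !(@coefs_mul_trunc n) // mulrC.
Qed.

Lemma fps_mulA : associative fps_mul.
Proof.
have coef3 f g h n :
    coefs (fps_mul f (fps_mul g h)) n = (trunc n f * (trunc n g * trunc n h))`_n.
  rewrite coefM; apply: eq_bigr => i _.
  rewrite coef_poly ltn_ord; congr (_ * _).
  by rewrite (@coefs_mul_trunc n) ?leq_subr.
move=> f g h; apply: fpsP => n.
by rewrite (fps_mulC (fps_mul f g)) !coef3 mulrA mulrC.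
Qed.

Lemma fps_mul1 : left_id (fpsC 1) fps_mul.
Proof.
move=> f; apply: fpsP => n /=.
rewrite big_ord_recl /= mul1r subn0 big1 ?addr0 // => i _.
by rewrite mul0r.
Qed.

Lemma fps_mulDl : left_distributive fps_mul fps_add.
Proof.
move=> f g h; apply: fpsP => n /=; rewrite -big_split.
by apply: eq_bigr => i _; rewrite /= mulrDl.
Qed.

Lemma fps_oner_neq0 : fpsC 1 != 0 :> fps R.
Proof.
by apply/eqP => /(congr1 (fun f => coefs f 0%N)) /= /eqP; rewrite oner_eq0.
Qed.

HB.instance Definition _ := GRing.Zmodule_isComNzRing.Build (fps R)
  fps_mulA fps_mulC fps_mul1 fps_mulDl fps_oner_neq0.

Definition fps_unit : pred (fps R) := fun f => `[< exists g, g * f = 1 >].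
Definition fps_inv f : fps R := xget f [set g | g * f = 1]%classic.

Lemma fps_mulVr : {in fps_unit, left_inverse 1 fps_inv *%R}.
Proof.
move=> f; rewrite unfold_in => /asboolP [g gf].
by rewrite /fps_inv; case: xgetP => [h _ //|/(_ g)]; case.
Qed.

Lemma fps_unitP f g : g * f = 1 -> fps_unit f.
Proof. by move=> gf; apply/asboolP; exists g. Qed.

Lemma fps_inv_out : {in [predC fps_unit], fps_inv =1 id}.
Proof.
move=> f; rewrite inE unfold_in => /asboolPn nf.
by rewrite /fps_inv; case: xgetP => // h _ hf; case: nf; exists h.
Qed.

HB.instance Definition _ := GRing.ComNzRing_hasMulInverse.Build (fps R)
  fps_mulVr fps_unitP fps_inv_out.

Lemma coefs0 n : coefs (0 : fps R) n = 0.
Proof. by rewrite /= if_same. Qed.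
Lemma coefs1 n : coefs (1 : fps R) n = (n == 0%N)%:R.
Proof. by rewrite /=; case: eqP. Qed.
Lemma coefsD f g n : coefs (f + g) n = coefs f n + coefs g n.
Proof. by []. Qed.
Lemma coefsN f n : coefs (- f) n = - coefs f n.
Proof. by []. Qed.
Lemma coefsM f g n :
  coefs (f * g) n = \sum_(i < n.+1) coefs f i * coefs g (n - i)%N.
Proof. by []. Qed.
Lemma coefsM0 f g : coefs (f * g) 0 = coefs f 0 * coefs g 0.
Proof. by rewrite coefsM big_ord1. Qed.

Lemma course_of_values (F : nat -> (nat -> R) -> R) :
  (forall n a b, (forall i, (i < n)%N -> a i = b i) -> F n a = F n b) ->
  exists a, forall n, a n = F n a.
Proof.
move=> Fext.
pose pre := fix pre n : nat -> R := if n is m.+1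
  then fun i => if i == m then F m (pre m) else pre m i else fun=> 0.
have preE n i : (i < n)%N -> pre n i = pre i.+1 i.
  elim: n => // n IHn; rewrite ltnS leq_eqVlt => /orP[/eqP -> //|lt_in].
  by rewrite [LHS]/= (ltn_eqF lt_in) IHn.
exists (fun n => pre n.+1 n) => n.
rewrite [LHS]/= eqxx; apply: Fext => i lt_in; exact: preE.
Qed.

Lemma fps_unitE f : (f \is a GRing.unit) = (coefs f 0 \is a GRing.unit).
Proof.
apply/idP/idP => [fU|f0U].
  apply/unitrPr; exists (coefs f^-1 0).
  by rewrite -coefsM0 mulrV.
pose F n (a : nat -> R) :=
  (coefs f 0)^-1 * ((n == 0%N)%:R - \sum_(i < n) coefs f i.+1 * a (n - i.+1)%N).
have [a aE] : exists a, forall n, a n = F n a.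
  apply: course_of_values => n a b eq_ab; congr (_ * (_ - _)).
  apply: eq_bigr => i _; rewrite eq_ab // ltn_subrL.
  exact: leq_ltn_trans (ltn_ord i).
apply/unitrPr; exists (Fps a); apply: fpsP => n.
rewrite coefsM coefs1 big_ord_recl /= subn0 aE mulVKr //.
by rewrite addrNK.
Qed.

Lemma fps_sqrt_exists f s : 2%:R * s \is a GRing.unit -> s ^+ 2 = coefs f 0 ->
  exists g, g ^+ 2 = f /\ coefs g 0 = s.
Proof.
move=> sU s2.
pose F n (a : nat -> R) := if n is m.+1
  then (2%:R * s)^-1 * (coefs f n - \sum_(i < m) a i.+1 * a (m - i)%N) else s.
have [a aE] : exists a, forall n, a n = F n a.
  apply: course_of_values => -[//|n] a b eq_ab /=; congr (_ * (_ - _)).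
  apply: eq_bigr => i _; by rewrite !eq_ab // ltnS ?leq_subr.
exists (Fps a); split; last exact: (aE 0%N).
apply: fpsP => -[|n]; rewrite expr2 coefsM.
  by rewrite big_ord1 /= (aE 0%N) -s2 expr2.
rewrite big_ord_recl big_ord_recr /= subn0 subnn (aE 0%N) /=.
have -> : \sum_(i < n) a (bump 0 i) * a (n.+1 - bump 0 i)%N =
          \sum_(i < n) a i.+1 * a (n - i)%N.
  by apply: eq_bigr => i _; rewrite /bump add1n subSS.
rewrite (mulrC _ s) addrCA -mulrDl -[s + s]mulr2n -mulr_natl.
by rewrite (aE n.+1) /= mulVKr // addrC subrK.
Qed.

End FpsRing.

(* Q[[x, y]] as Q[[y]][[x]]: the coefficient of x^n is a series in y. *)
Notation fps2 := (fps (fps rat)).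

Definition coefs2 (f : fps2) (n k : nat) : rat := coefs (coefs f n) k.
Definition varx : fps2 := fpsX (fps rat).
Definition vary : fps2 := fpsC (fpsX rat).

Lemma fps2_unitE (f : fps2) : (f \is a GRing.unit) = (coefs2 f 0 0 != 0).
Proof. by rewrite !fps_unitE unitfE. Qed.

Definition sqrt_fps2 (f : fps2) : fps2 :=
  xget 0 [set g : fps2 | g ^+ 2 = f /\ coefs2 g 0 0 = 1]%classic.

Lemma sqrt_fps2P (f : fps2) : coefs2 f 0 0 = 1 ->
  sqrt_fps2 f ^+ 2 = f /\ coefs2 (sqrt_fps2 f) 0 0 = 1.
Proof.
move=> f1; have [s [s2 s0]] : exists s, s ^+ 2 = coefs f 0 /\ coefs s 0 = 1.
  by apply: fps_sqrt_exists; rewrite ?unitfE ?mulr1 // expr1n.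
have [|g [g2 g0]] := fps_sqrt_exists _ s2.
  by rewrite fps_unitE coefsM0 s0 unitfE.
rewrite /sqrt_fps2; case: xgetP => [h _ //|/(_ g)]; case; split=> //.
by rewrite /coefs2 g0.
Qed.

Lemma sqrt_fps2_unique (f g : fps2) :
  g ^+ 2 = f -> coefs2 g 0 0 = 1 -> sqrt_fps2 f = g.
Proof.
move=> g2 g1.
have f1 : coefs2 f 0 0 = 1.
  by rewrite -g2 expr2 /coefs2 !coefsM0 [coefs (coefs g 0) 0]g1 mulr1.
have [h2 h1] := sqrt_fps2P f1.
have : sqrt_fps2 f + g \is a GRing.unit.
  by rewrite fps2_unitE /coefs2 !coefsD [X in X + _]h1 [X in _ + X]g1.
move=> hgU; apply/eqP; rewrite -subr_eq0; apply/eqP/(mulIr hgU).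
by rewrite mul0r -subr_sqr h2 g2 subrr.
Qed.

Local Close Scope ring_scope.

(* Letters are 'I_k = {0, ..., k-1} instead of {1, ..., k}; only their order
   matters. *)

(* u1 v1 u2 v2 ...; the leftover letters are appended once a word is exhausted *)
Fixpoint interlace (T : Type) (u v : seq T) : seq T :=
  match u, v with
  | a :: u', b :: v' => a :: b :: interlace u' v'
  | [::], _ => v
  | _, [::] => u
  end.

Definition nondecreasing_word (k : nat) (u : seq 'I_k) : bool :=
  sorted (fun a b : 'I_k => a <= b) u.

Definition faro (k : nat) (w : seq 'I_k) : Prop :=
  exists u v : seq 'I_k,
    [/\ nondecreasing_word u, nondecreasing_word v,
        size v <= size u <= (size v).+1 & w = interlace u v].

Definition faro_words (n k : nat) : {set n.-tuple 'I_k} :=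
  [set w : n.-tuple 'I_k | `[< faro w >]].

Inductive pattern := P11 | P12 | P21.

Definition matches (p : pattern) (a b : nat) : bool :=
  match p with P11 => a == b | P12 => a < b | P21 => a > b end.

Definition occurrences (p : pattern) (w : seq nat) : nat :=
  count (fun i => matches p (nth 0 w i) (nth 0 w i.+1)) (iota 0 (size w).-1).

Definition popularity (p : pattern) (n k : nat) : nat :=
  \sum_(w in faro_words n k) occurrences p [seq val a | a <- w].

Definition popularity_gf (p : pattern) : fps2 :=
  Fps (fun n => Fps (fun k =>
    if 0 < k then ((popularity p n k)%:R)%R else 0%R)).

(* Main.v *)
Require Import Defs.
From mathcomp Require Import all_boot all_order all_algebra.
From mathcomp Require Import boolp zify ring.

(** A faro word is a pair of nondecreasing words u, v read alternately, so all
    counts are products of multiset numbers.  At an occurrence of 11 with letter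
    a, the letters before it form a faro word over the letters up to a and those
    after it a faro word over the letters from a on, both arbitrary
    ([popularity11]).  At an occurrence of 21 with smaller letter a, let e
    be the number of letters greater than a that precede it; they all belong to
    the word of the greater letter of the occurrence.  Once a and e are fixed, the
    preceding letters that are at most a and all the remaining ones are again
    chosen independently ([popularity21]).

    Both counts are therefore governed by the series T_e ([gap_series e]) of the
    pairs of nondecreasing words one of which is longer than the other by e or
    e + 1.  Pascal's rule in each of the two words
    gives
      (1 - y + x^2) T_(e+1) = T_e + x^2 T_(e+2),
      (1 - y + x^2) T_0     = 1 + x T_0 + x^2 T_1.
    Let c be the root with constant term 1 of c^2 + x^2 = (1 - y + x^2) c, that is
    c = (1 - y + x^2 + A_1) / 2.  The first recurrence forces c T_(e+1) = T_e,
    because the difference of the two sides is infinitely divisible by x, and then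
    the second one gives T_e = c^(-e) / (c - x) ([gap_seriesE]).  Consequently
      G_11 = x^2 y T_0^2   and
      G_21 = x^2 y sum_e x^(2e) T_e (T_(e+1) - T_e),
    and the latter sum is geometric of ratio x^2 / c^2.

    Finally each of the n - 1 adjacencies of a word of length n is an occurrence
    of exactly one of the patterns, so G_11 + G_21 + G_12 is obtained from the
    series y T_0 of all faro words by the operator x d/dx
    ([popularity_gf_total]).  This operator is a derivation, which makes the
    derivatives of c and T_0 rational in x, y and c; the formula for G_12 is then
    an identity modulo the quadratic equation of c ([gf12_identity]). *)

Set Implicit Arguments.
Unset Strict Implicit.
Unset Printing Implicit Defensive.
Import GRing.Theory.

(** * Multiset numbers and nondecreasing words *)

(** The number of multisets of size [m] on [j] letters; the truncated
    predecessor gives the right values for [j = 0] as well. *)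
Definition multichoose m j := 'C((m + j).-1, m).

Lemma multichoose0 j : multichoose 0 j = 1.
Proof. exact: bin0. Qed.

Lemma multichooseS0 m : multichoose m.+1 0 = 0.
Proof. by rewrite /multichoose addn0 bin_small. Qed.

Lemma multichooseSS m j :
  multichoose m.+1 j.+1 = multichoose m.+1 j + multichoose m j.+1.
Proof. by rewrite /multichoose addSn addnS /= binS. Qed.

(** Hockey-stick identity, in the form produced by summing over the first letter
    [b] of a nondecreasing word. *)
Lemma sum_multichoose m lo hi :
  \sum_(lo <= b < hi) multichoose m (hi - b) = multichoose m.+1 (hi - lo).
Proof.
have [le_hi|lt_lo] := leqP hi lo.
  by rewrite big_geq // (eqP le_hi) multichooseS0.
rewrite -(subnKC (ltnW lt_lo)) addKn; move: (hi - lo) => d {lt_lo hi}.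
elim: d lo => [|d IHd] lo; first by rewrite big_geq ?addn0 // multichooseS0.
rewrite addnS big_ltn ?ltnS ?leq_addr // -addSn IHd multichooseSS addnC.
by rewrite addSn -addnS addKn.
Qed.

(** Enumerating the nondecreasing words of length [m] over [lo, hi) by their first
    letter, as plain sequences of numbers, lets the bound [lo] vary in inductions
    on [m]. *)
Fixpoint sorted_words hi m lo : seq (seq nat) :=
  if m is m'.+1
  then [seq a :: t | a <- index_iota lo hi, t <- sorted_words hi m' a]
  else [:: [::]].

Lemma mem_sorted_words hi m lo t :
  (t \in sorted_words hi m lo) =
  [&& size t == m, path leq lo t & all (gtn hi) t].
Proof.
elim: m lo t => [|m IHm] lo [|a t] //=.
  by apply/allpairsPdep => -[? [? []]].
apply/allpairsPdep/idP => [[b [s [+ + [-> ->]]]]|].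
  by rewrite mem_index_iota IHm eqSS => /andP[-> ->] /and3P[-> -> ->].
rewrite eqSS => /and3P[szt /andP[le_lo pt] /andP[lt_hi lt_t]].
by exists a, t; split; rewrite ?mem_index_iota ?IHm ?le_lo //; apply/and3P.
Qed.

Lemma sorted_words_uniq hi m lo : uniq (sorted_words hi m lo).
Proof.
elim: m lo => [//|m IHm] lo.
apply: allpairs_uniq_dep => //; first exact: iota_uniq.
by move=> [a s] [b t] _ _ [-> ->].
Qed.

Lemma big_sorted_wordsS hi m lo (F : seq nat -> nat) :
  \sum_(t <- sorted_words hi m.+1 lo) F t =
  \sum_(lo <= a < hi) \sum_(t <- sorted_words hi m a) F (a :: t).
Proof. exact: big_allpairs_dep. Qed.

Lemma count_sorted_words hi m lo :
  \sum_(t <- sorted_words hi m lo) 1 = multichoose m (hi - lo).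
Proof.
elim: m lo => [|m IHm] lo; first by rewrite big_seq1 multichoose0.
rewrite big_sorted_wordsS -sum_multichoose; exact: eq_bigr.
Qed.

#[local] Arguments sorted_words : simpl never.

Lemma sorted_words_nth_ge hi m lo t p :
  t \in sorted_words hi m lo -> p < m -> lo <= nth 0 t p.
Proof.
rewrite mem_sorted_words => /and3P[/eqP <- pt _] lt_p.
by move/all_nthP: (order_path_min leq_trans pt); apply.
Qed.

Lemma count_sorted_words_nth_eq hi r p a lo : a < hi ->
  \sum_(t <- sorted_words hi (p + r.+1) lo) (nth 0 t p == a) =
  (lo <= a) * (multichoose p (a.+1 - lo) * multichoose r (hi - a)).
Proof.
move=> lt_a; elim: p lo => [|p IHp] lo; rewrite ?addSn big_sorted_wordsS /=.
  rewrite multichoose0 mul1n -count_sorted_words.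
  rewrite (eq_bigr (fun b =>
      if b == a then \sum_(t <- sorted_words hi r b) 1 else 0)); last first.
    by move=> b _; case: eqP => //= _; rewrite big1.
  rewrite -big_mkcond big_nat1_eq lt_a andbT; by case: leqP; rewrite ?mul1n.
under eq_bigr do rewrite IHp.
rewrite -sum_multichoose big_distrl big_distrr /=.
rewrite (big_nat_widen _ a.+1 hi) // [RHS]big_mkcond /= !big_nat.
apply: eq_bigr => b /andP[le_lo _]; rewrite ltnS.
by case: (leqP b a) => // le_b; rewrite (leq_trans le_lo le_b) !mul1n.
Qed.

(** Let [s] be the number of letters of the word that are at most [a].  The letter
    at position [p] exceeds [a] exactly when [s <= p], and the [s] small letters
    and the [m - s] large ones are then chosen independently. *)
Lemma count_sorted_words_nth_gt hi m p a lo : a < hi -> p < m -> lo <= a ->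
  \sum_(t <- sorted_words hi m lo) (a < nth 0 t p) =
  \sum_(s < p.+1) multichoose s (a.+1 - lo) * multichoose (m - s) (hi - a.+1).
Proof.
move=> lt_a; elim: p m lo => [|p IHp] [//|m] lo lt_pm le_lo.
  rewrite big_ord1 subn0 multichoose0 mul1n big_sorted_wordsS.
  (* The first letter [b] must exceed [a]; then all letters do. *)
  rewrite (@big_cat_nat _ _ _ a.+1) ?(leqW le_lo) //= big_nat_cond big1.
    rewrite add0n -sum_multichoose !big_nat; apply: eq_bigr => b /andP[lt_ab _].
    by rewrite -count_sorted_words; apply: eq_bigr => t _; rewrite lt_ab.
  move=> b /andP[/andP[_ le_ba] _]; apply: big1 => t _.
  by rewrite ltnNge -ltnS le_ba.
(* A first letter greater than [a] accounts for [s = 0], the others for [s > 0]. *)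
rewrite big_ord_recl subn0 multichoose0 mul1n big_sorted_wordsS.
rewrite (@big_cat_nat _ _ _ a.+1) ?(leqW le_lo) //= addnC; congr (_ + _).
  rewrite -sum_multichoose !big_nat; apply: eq_bigr => b /andP[lt_ab _].
  rewrite -count_sorted_words !big_seq; apply: eq_bigr => t tW.
  by rewrite (leq_trans lt_ab (sorted_words_nth_ge tW lt_pm)).
rewrite big_nat; under eq_bigr => b /andP[_ le_ba] do rewrite IHp //.
rewrite -big_nat exchange_big; apply: eq_bigr => s _ /=.
by rewrite -big_distrl sum_multichoose subSS.
Qed.

(** * Faro words as pairs of nondecreasing words *)

Lemma size_interlace (T : Type) (u v : seq T) :
  size (interlace u v) = size u + size v.
Proof. by elim: u v => [|a u IHu] [|b v] //=; rewrite ?addn0 // IHu addnS. Qed.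

Lemma nth_interlace (T : Type) (x0 : T) (u v : seq T) i :
  size v <= size u <= (size v).+1 ->
  nth x0 (interlace u v) i = nth x0 (if odd i then v else u) i./2.
Proof.
elim: u v i => [|a u IHu] [|b v] //=.
- by move=> i _; rewrite if_same !nth_nil.
- by case: u {IHu} => // -[|[|i]] _ //=; case: ifP => _; rewrite /= ?nth_nil.
- by case=> [|[|i]] //=; rewrite !ltnS => /IHu-> ; rewrite negbK; case: odd.
Qed.

Lemma size_halves a b n :
  b <= a <= b.+1 -> a + b = n -> a = uphalf n /\ b = n./2.
Proof. by case/andP=> le_ba le_ab <-; split; lia. Qed.

Lemma map_interlace (S T : Type) (f : S -> T) u v :
  map f (interlace u v) = interlace (map f u) (map f v).
Proof. by elim: u v => [|a u IHu] [|b v] //=; rewrite IHu. Qed.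

Lemma interlace_inj (T : Type) (u v u' v' : seq T) :
  size u = size u' -> size v = size v' ->
  interlace u v = interlace u' v' -> u = u' /\ v = v'.
Proof.
elim: u u' v v' => [|a u IHu] [|a' u'] [|b v] [|b' v'] //=.
by case=> eq_u [eq_v] [-> -> /(IHu _ _ _ eq_u eq_v)[-> ->]].
Qed.

Lemma lift_word k t : all (gtn k) t -> exists u : seq 'I_k, map val u = t.
Proof.
elim: t => [|a t IHt] /=; first by exists [::].
by case/andP=> lt_a /IHt[u <-]; exists (Ordinal lt_a :: u).
Qed.

(** Interlacing is injective on pairs of words of given lengths, so sums over faro
    words become double sums over nondecreasing words. *)
Lemma faro_words_enum n k :
  perm_eq [seq map val (val w) | w <- enum (faro_words n k)]
    [seq interlace u v | u <- sorted_words k (uphalf n) 0,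
                         v <- sorted_words k n./2 0].
Proof.
have mem_val m (u : seq 'I_k) :
    (map val u \in sorted_words k m 0) = (size u == m) && nondecreasing_word u.
  rewrite mem_sorted_words size_map path_min_sorted; last by apply/allP.
  rewrite sorted_map /nondecreasing_word [all _ _](_ : _ = true) ?andbT //.
  by apply/allP => _ /mapP[a _ ->]; exact: ltn_ord.
apply: uniq_perm.
- rewrite map_inj_uniq ?enum_uniq // => w w' /inj_map eq_ww'.
  by apply/val_inj/eq_ww'/val_inj.
- apply: allpairs_uniq; rewrite ?sorted_words_uniq // => -[u v] [u' v'].
  move=> /allpairsP[[? ?] /= [+ + [-> ->]]] /allpairsP[[? ?] /= [+ + [-> ->]]].
  rewrite !mem_sorted_words => /andP[/eqP s1 _] /andP[/eqP s2 _].
  move=> /andP[/eqP s3 _] /andP[/eqP s4 _].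
  by case/interlace_inj; rewrite ?s1 ?s2 ?s3 ?s4 // => -> ->.
move=> s; apply/mapP/allpairsP => [[w + ->]|[[t1 t2] /= [+ + ->]]].
  rewrite mem_enum inE => /asboolP[u [v [nd_u nd_v size_uv w_uv]]].
  exists (map val u, map val v).
  rewrite /= w_uv map_interlace !mem_val nd_u nd_v.
  have := size_tuple w; rewrite w_uv size_interlace => size_w.
  by have [-> ->] := size_halves size_uv size_w; rewrite !eqxx; split.
move=> t1W t2W; move: (t1W) (t2W); rewrite !mem_sorted_words.
case/and3P=> _ _ /lift_word[u def_u] /and3P[_ _ /lift_word[v def_v]].
move: t1W t2W; rewrite -def_u -def_v !mem_val.
case/andP=> /eqP size_u nd_u /andP[/eqP size_v nd_v].
have size_uv : size (interlace u v) = n by rewrite size_interlace; lia.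
exists (tcast size_uv (in_tuple (interlace u v))); last first.
  by rewrite val_tcast map_interlace.
rewrite mem_enum inE; apply/asboolP; exists u, v.
split=> //; last by rewrite val_tcast.
by rewrite size_u size_v; apply/andP; lia.
Qed.

(** The letters at positions [i] and [i + 1] come from different words.  Naming the
    two words after these positions, rather than by their place in the
    interlacing, treats even and odd [i] alike. *)
Lemma popularityE p n k :
  popularity p n.+2 k =
  \sum_(i < n.+1)
    \sum_(x <- sorted_words k (i./2 + (uphalf (n - i)).+1) 0)
    \sum_(y <- sorted_words k (uphalf i + (n - i)./2.+1) 0)
      matches p (nth 0 x i./2) (nth 0 y (uphalf i)).
Proof.
rewrite /popularity -big_enum /=.
rewrite -(big_map (fun w : n.+2.-tuple 'I_k => map val (val w)) predT
  (occurrences p)).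
rewrite (perm_big _ (faro_words_enum _ _)) big_allpairs_dep /=.
pose F i u v : nat :=
  matches p (nth 0 (interlace u v) i) (nth 0 (interlace u v) i.+1).
transitivity (\sum_(u <- sorted_words k (uphalf n.+2) 0)
  \sum_(v <- sorted_words k n.+2./2 0) \sum_(i < n.+1) F i u v).
  rewrite !big_seq; apply: eq_bigr => u.
  rewrite mem_sorted_words => /and3P[/eqP su _ _].
  rewrite !big_seq; apply: eq_bigr => v.
  rewrite mem_sorted_words => /and3P[/eqP sv _ _].
  rewrite /occurrences size_interlace su sv.
  have -> : (uphalf n.+2 + n.+2./2).-1 = n.+1 by lia.
  rewrite -(big_mkord xpredT (fun i => F i u v)) /index_iota subn0.
  rewrite -sum1_count big_mkcond.
  by apply: eq_bigr => i _; rewrite /F; case: matches.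
under eq_bigr do rewrite exchange_big.
rewrite exchange_big; apply: eq_bigr => -[i lt_i] _ /=.
have sizes : n.+2./2 <= uphalf n.+2 <= n.+2./2.+1 by apply/andP; lia.
rewrite ltnS in lt_i.
case: (boolP (odd i)) => odd_i.
  rewrite exchange_big.
  have -> : i./2 + (uphalf (n - i)).+1 = n.+2./2 by lia.
  have -> : uphalf i + (n - i)./2.+1 = uphalf n.+2 by lia.
  rewrite !big_seq; apply: eq_bigr => v.
  rewrite mem_sorted_words => /and3P[/eqP sv _ _].
  rewrite !big_seq; apply: eq_bigr => u.
  rewrite mem_sorted_words => /and3P[/eqP su _ _].
  by rewrite /F !nth_interlace ?su ?sv //= odd_i.
have -> : i./2 + (uphalf (n - i)).+1 = uphalf n.+2 by lia.
have -> : uphalf i + (n - i)./2.+1 = n.+2./2 by lia.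
rewrite !big_seq; apply: eq_bigr => u.
rewrite mem_sorted_words => /and3P[/eqP su _ _].
rewrite !big_seq; apply: eq_bigr => v.
rewrite mem_sorted_words => /and3P[/eqP sv _ _].
rewrite /F !nth_interlace ?su ?sv //= (negPf odd_i) /=.
by congr (matches _ _ (nth _ _ _)); lia.
Qed.

(** Conditioning on the letter [a] of the second word decouples the two words. *)
Lemma sum_pivot (X Y : seq (seq nat)) hi p q (r : nat -> nat -> bool) :
  (forall y, y \in Y -> nth 0 y q < hi) ->
  \sum_(x <- X) \sum_(y <- Y) r (nth 0 x p) (nth 0 y q) =
  \sum_(a < hi) (\sum_(x <- X) r (nth 0 x p) a) *
    \sum_(y <- Y) (nth 0 y q == a).
Proof.
move=> lt_Y; under [RHS]eq_bigr do rewrite big_distrl.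
rewrite [RHS]exchange_big; apply: eq_bigr => x _ /=.
under [RHS]eq_bigr do rewrite big_distrr.
rewrite [RHS]exchange_big !big_seq; apply: eq_bigr => y yY.
rewrite (bigD1 (Ordinal (lt_Y y yY))) //= eqxx muln1 big1 ?addn0 // => a.
by rewrite -val_eqE eq_sym /= => /negPf->; rewrite muln0.
Qed.

Lemma sorted_words_nth_lt hi m lo t p :
  t \in sorted_words hi m lo -> p < m -> nth 0 t p < hi.
Proof.
rewrite mem_sorted_words => /and3P[/eqP <- _ lt_hi] lt_p.
by move/all_nthP: lt_hi; apply.
Qed.

Lemma popularity11 n k :
  popularity P11 n.+2 k.+1 =
  \sum_(i < n.+1) \sum_(a < k.+1)
    (multichoose i./2 a.+1 * multichoose (uphalf i) a.+1) *
    (multichoose (n - i)./2 (k - a).+1 *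
     multichoose (uphalf (n - i)) (k - a).+1).
Proof.
rewrite popularityE; apply: eq_bigr => i _.
rewrite (@sum_pivot _ _ k.+1); last first.
  by move=> y /sorted_words_nth_lt; apply; rewrite addnS ltnS leq_addr.
apply: eq_bigr => a _; rewrite /= !count_sorted_words_nth_eq // !subn0 !mul1n.
have le_ak : a <= k by rewrite -ltnS.
by rewrite subSn // mulnACA; congr (_ * _); exact: mulnC.
Qed.

(** Here [e = i./2 - s], where [s] is the number of letters at most [a] in the word
    of the greater letter.  Indexing by [e] makes the factors before and after
    position [i] coefficients of series that depend on [e] alone. *)
Lemma popularity21 n k :
  popularity P21 n.+2 k.+1 =
  \sum_(i < n.+1) \sum_(a < k.+1) \sum_(e < i./2.+1)
    (multichoose (i./2 - e) a.+1 * multichoose (uphalf i) a.+1) *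
    (multichoose (n - i)./2 (k - a).+1 *
     multichoose (uphalf (n - i) + e).+1 (k - a)).
Proof.
rewrite popularityE; apply: eq_bigr => i _.
rewrite (@sum_pivot _ _ k.+1); last first.
  by move=> y /sorted_words_nth_lt; apply; rewrite addnS ltnS leq_addr.
apply: eq_bigr => a _; rewrite /= count_sorted_words_nth_eq //.
rewrite count_sorted_words_nth_gt //; last by rewrite addnS ltnS leq_addr.
rewrite big_distrl (reindex_inj rev_ord_inj); apply: eq_bigr => e _.
have le_ak : a <= k by rewrite -ltnS.
have le_ei : e <= i./2 by rewrite -ltnS.
have -> : i./2 + (uphalf (n - i)).+1 - rev_ord e = (uphalf (n - i) + e).+1.
  by rewrite /= subSS subnBA // -addnA addKn addSn.
rewrite !subn0 mul1n /= !subSS subSn //.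
by rewrite mulnACA; congr (_ * _); exact: mulnC.
Qed.

Lemma popularity_short p n k : n <= 1 -> popularity p n k = 0.
Proof.
move=> le_n1; apply: big1 => w _.
by rewrite /occurrences size_map size_tuple; case: n w le_n1 => [|[]].
Qed.

Lemma popularity_total n k :
  popularity P11 n k + popularity P21 n k + popularity P12 n k =
  n.-1 * (multichoose (uphalf n) k * multichoose n./2 k).
Proof.
rewrite -!big_split /=.
transitivity (\sum_(w in faro_words n k) n.-1).
  apply: eq_bigr => w _; rewrite /occurrences size_map size_tuple.
  rewrite -!sumn_count !sumnE !big_map -!big_split /=.
  under eq_bigr => i _.
    rewrite (_ : _ + _ = 1); last by case: ltngtP.
    over.
  by rewrite sum1_size size_iota.
rewrite sum_nat_const mulnC; congr (_ * _).
rewrite -sum1_card -big_enum.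
rewrite -(big_map (fun w : n.-tuple 'I_k => map val (val w)) predT
  (fun=> 1)) /=.
rewrite (perm_big _ (faro_words_enum _ _)) big_allpairs_dep /=.
under eq_bigr do rewrite count_sorted_words -[multichoose _ _]mul1n.
by rewrite -big_distrl /= count_sorted_words !subn0.
Qed.

(** * Coefficients and Euler derivative of power series *)

Local Open Scope ring_scope.

Section FpsCoefs.
Variable R : comUnitRingType.
Implicit Types f g : fps R.

Lemma coefs_sum I (r : seq I) (P : pred I) (F : I -> fps R) n :
  coefs (\sum_(i <- r | P i) F i) n = \sum_(i <- r | P i) coefs (F i) n.
Proof.
exact: (big_morph (fun f : fps R => coefs f n) (fun f g => coefsD f g n)
  (coefs0 _ n)).
Qed.

Lemma coefs_fpsCM (a : R) f n : coefs (fpsC a * f) n = a * coefs f n.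
Proof.
rewrite coefsM big_ord_recl subn0 big1 ?addr0 // => i _.
by rewrite mul0r.
Qed.

Lemma coefs_fpsXM f n :
  coefs (fpsX R * f) n = if n is m.+1 then coefs f m else 0.
Proof.
case: n => [|n]; first by rewrite coefsM0 mul0r.
rewrite coefsM big_ord_recl mul0r add0r big_ord_recl mul1r subSS subn0.
by rewrite big1 ?addr0 // => i _; rewrite mul0r.
Qed.

Lemma coefs_fpsXnM f m n :
  coefs (fpsX R ^+ m * f) n = if (m <= n)%N then coefs f (n - m) else 0.
Proof.
elim: m n => [|m IHm] n; first by rewrite mul1r subn0.
by rewrite exprS -mulrA coefs_fpsXM; case: n => // n; rewrite IHm.
Qed.

(** Iterating the hypothesis shows that [u e] is divisible by every power of the
    variable. *)
Lemma fpsX_divisible_eq0 (u : nat -> fps R) w :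
  (forall e, u e = fpsX R * (w * u e.+1)) -> forall e, u e = 0.
Proof.
move=> uE; suff u0 n m e : (m < n)%N -> coefs (u e) m = 0.
  by move=> e; apply: fpsP => m; rewrite coefs0 (u0 m.+1).
elim: n m e => // n IHn m e; rewrite uE coefs_fpsXM; case: m => // m lt_mn.
rewrite coefsM big1 // => i _; rewrite IHn ?mulr0 //.
exact: (leq_ltn_trans (leq_subr i m) (lt_mn : (m < n)%N)).
Qed.

(** The derivation X d/dX. *)
Definition euler f := Fps (fun n => coefs f n *+ n).

Lemma coefs_euler f n : coefs (euler f) n = coefs f n *+ n.
Proof. by []. Qed.

Lemma eulerD f g : euler (f + g) = euler f + euler g.
Proof. by apply: fpsP => n; rewrite /= mulrnDl. Qed.

Lemma eulerN f : euler (- f) = - euler f.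
Proof. by apply: fpsP => n; rewrite /= mulNrn. Qed.

Lemma eulerM f g : euler (f * g) = euler f * g + f * euler g.
Proof.
apply: fpsP => n; rewrite coefsD !coefsM [LHS]/= -sumrMnl -big_split /=.
apply: eq_bigr => i _; rewrite mulrnAl mulrnAr -mulrnDr subnKC //.
by rewrite -ltnS.
Qed.

Lemma euler_fpsC a : euler (fpsC a) = 0.
Proof. by apply: fpsP => -[|n]; rewrite coefs0 /= ?mulr0n ?mul0rn. Qed.

Lemma euler1 : euler 1 = 0.
Proof. exact: euler_fpsC. Qed.

Lemma euler_fpsX : euler (fpsX R) = fpsX R.
Proof. by apply: fpsP => -[|[|n]]; rewrite /= ?mulr0n ?mul0rn. Qed.

End FpsCoefs.

(** * Pairs of nondecreasing words whose lengths differ by a given amount *)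

(** Alphabets of size [k + 1] are recorded at exponent [k], so that concatenating
    two words at a shared letter corresponds to multiplying series. *)
Definition pair_series a b : fps rat :=
  Fps (fun k => (multichoose a k.+1 * multichoose b k.+1)%:R).

(** At x-exponent [n] the lengths are those of the two words of a faro word of
    length [n], the length of the first one being increased by [e]. *)
Definition gap_series e : fps2 :=
  Fps (fun n => pair_series n./2 (uphalf n + e)).

Lemma pair_seriesC a b : pair_series a b = pair_series b a.
Proof. by apply: fpsP => k; rewrite /= mulnC. Qed.

Lemma pair_series00 : (1 - fpsX rat) * pair_series 0 0 = 1.
Proof.
apply: fpsP => k; rewrite mulrBl mul1r coefsD coefsN coefs_fpsXM coefs1.
by case: k => [|k] /=; rewrite ?multichoose0 ?subr0 ?subrr.
Qed.

Lemma pair_series0S b :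
  (1 - fpsX rat) * pair_series 0 b.+1 = pair_series 0 b.
Proof.
apply: fpsP => k; rewrite mulrBl mul1r coefsD coefsN coefs_fpsXM /=.
case: k => [|k]; rewrite !multichoose0 !mul1n multichooseSS.
  by rewrite multichooseS0 subr0.
by rewrite /= natrD addrC addKr.
Qed.

(** By Pascal's rule, subtracting the count for a word shorter by 1 leaves the
    count for one letter less.  Doing so for both words lowers the y-exponent by 1,
    hence the four terms. *)
Lemma pair_seriesSS a b :
  (1 - fpsX rat) * pair_series a.+1 b.+1 + pair_series a b =
  pair_series a b.+1 + pair_series a.+1 b.
Proof.
apply: fpsP => k; rewrite mulrBl mul1r !coefsD coefsN coefs_fpsXM /=.
rewrite !multichooseSS.
case: k => [|k]; rewrite ?multichooseS0 !(natrM, natrD) /=; ring.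
Qed.

Lemma pair_seriesB a b k :
  coefs (pair_series a b.+1 - pair_series a b) k =
  (multichoose a k.+1 * multichoose b.+1 k)%:R.
Proof.
rewrite coefsD coefsN /= multichooseSS -natrB ?leq_mul2l ?leq_addl ?orbT //.
by rewrite -mulnBr addnK.
Qed.

Lemma coefs_varyM (f : fps2) n : coefs (vary * f) n = fpsX rat * coefs f n.
Proof. exact: coefs_fpsCM. Qed.

Lemma coefs_1ByM (f : fps2) n :
  coefs ((1 - vary) * f) n = (1 - fpsX rat) * coefs f n.
Proof. by rewrite !mulrBl !mul1r coefsD coefsN coefs_varyM. Qed.

Lemma gap_series_recS e :
  (1 - vary + varx ^+ 2) * gap_series e.+1 =
  gap_series e + varx ^+ 2 * gap_series e.+2.
Proof.
apply: fpsP => n; rewrite mulrDl !coefsD coefs_1ByM !coefs_fpsXnM.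
case: n => [|[|n]] /=; rewrite ?addr0 ?add0n ?add1n ?pair_series0S //.
rewrite ?subSS ?subn0.
by rewrite !addSn !addnS pair_seriesSS addrC.
Qed.

Lemma gap_series_rec0 :
  (1 - vary + varx ^+ 2) * gap_series 0 =
  1 + varx * gap_series 0 + varx ^+ 2 * gap_series 1.
Proof.
apply: fpsP => n; rewrite mulrDl !coefsD coefs_1ByM !coefs_fpsXnM coefs_fpsXM.
case: n => [|[|n]]; rewrite ?coefs1.
- by rewrite /= !addr0 pair_series00.
- by rewrite /= !addr0 add0r pair_series0S.
rewrite add0r /= !subSS subn0 !addn0 addn1 pair_seriesSS addrC; congr (_ + _).
exact: pair_seriesC.
Qed.

(** * Closed form of the gap series *)

Section Kernel.
Local Notation x := varx.
Local Notation y := vary.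
Variable c : fps2.
Hypotheses (cU : c \is a GRing.unit) (cxU : c - x \is a GRing.unit).
Hypothesis cE : c ^+ 2 + x ^+ 2 = (1 - y + x ^+ 2) * c.

Lemma kernelE : 1 - y + x ^+ 2 = c + x ^+ 2 * c^-1.
Proof.
by apply: (mulIr cU); rewrite -cE mulrDl -mulrA mulVr // mulr1 expr2.
Qed.

(** With U_e = c T_(e+1) - T_e, the recurrence reads U_e = x^2 c^-1 U_(e+1),
    because 1 - y + x^2 is the sum c + x^2 / c of the two roots of the equation
    of c.  Hence every power of x divides U_e. *)
Lemma gap_series_step e : c * gap_series e.+1 = gap_series e.
Proof.
apply/eqP; rewrite -subr_eq0; apply/eqP.
apply: (fpsX_divisible_eq0 (u := fun e => c * gap_series e.+1 - gap_series e)
  (w := varx * c^-1)) => {}e.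
have := gap_series_recS e; rewrite kernelE => rec.
have -> : c * gap_series e.+1 - gap_series e =
    (c + x ^+ 2 * c^-1) * gap_series e.+1 - gap_series e
    - x ^+ 2 * c^-1 * gap_series e.+1 by ring.
rewrite rec -/varx.
transitivity (x ^+ 2 * (c * c^-1) * gap_series e.+2
  - x ^+ 2 * c^-1 * gap_series e.+1); last by ring.
by rewrite mulrV //; ring.
Qed.

Lemma gap_series0 : gap_series 0 = (c - x)^-1.
Proof.
apply: (mulrI cxU); rewrite mulrV //.
have := gap_series_rec0; rewrite kernelE => rec.
rewrite -[1](addrK (x * gap_series 0 + x ^+ 2 * gap_series 1)) addrA -rec.
rewrite -(gap_series_step 0).
transitivity (c * (c * gap_series 1) + x ^+ 2 * (c * c^-1) * gap_series 1
  - (x * (c * gap_series 1) + x ^+ 2 * gap_series 1)); last by ring.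
by rewrite mulrV //; ring.
Qed.

Lemma gap_seriesE e : gap_series e = c^-1 ^+ e * (c - x)^-1.
Proof.
elim: e => [|e IHe]; first by rewrite mul1r gap_series0.
by rewrite exprS -mulrA -IHe -(gap_series_step e) mulrA mulVr ?mul1r.
Qed.

End Kernel.

(** * Generating functions of the popularities *)

Lemma coefs_shift (f : fps2) n :
  coefs (varx ^+ 2 * vary * f) n =
  if (2 <= n)%N then fpsX rat * coefs f (n - 2) else 0.
Proof. by rewrite -mulrA coefs_fpsXnM coefs_varyM. Qed.

Lemma coefs2_shift (f : fps2) n k :
  coefs2 (varx ^+ 2 * vary * f) n k =
  if n is m.+2 then (if k is l.+1 then coefs2 f m l else 0) else 0.
Proof.
rewrite /coefs2 coefs_shift.
by case: n => [|[|n]]; rewrite ?coefs0 // !subSS subn0 coefs_fpsXM; case: k.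
Qed.

Lemma coefs2M (f g : fps2) n k :
  coefs2 (f * g) n k =
  \sum_(i < n.+1) \sum_(a < k.+1) coefs2 f i a * coefs2 g (n - i) (k - a).
Proof. by rewrite /coefs2 coefsM coefs_sum. Qed.

Lemma popularity_gf11 :
  popularity_gf P11 = varx ^+ 2 * vary * gap_series 0 ^+ 2.
Proof.
apply: fpsP => n; apply: fpsP => k; rewrite -![RHS]/(coefs2 _ n k) coefs2_shift.
case: n => [|[|n]]; case: k => [|k] //=; try by rewrite popularity_short.
rewrite expr2 coefs2M popularity11 natr_sum; apply: eq_bigr => i _.
rewrite natr_sum; apply: eq_bigr => a _.
by rewrite /coefs2 /= !addn0 natrM.
Qed.

(** Only the terms with [2 e <= n] reach the x-exponent [n], so a finite sum carries
    any given coefficient of the series over all [e]. *)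
Definition descent_series N :=
  \sum_(e < N) varx ^+ e.*2 * gap_series e * (gap_series e.+1 - gap_series e).

Lemma popularity_gf21 n :
  coefs (popularity_gf P21) n =
  coefs (varx ^+ 2 * vary * descent_series n) n.
Proof.
apply: fpsP => k; rewrite -![RHS]/(coefs2 _ n k) coefs2_shift.
case: n => [|[|n]]; case: k => [|k] //=; try by rewrite popularity_short.
rewrite /descent_series {1}/coefs2 !coefs_sum.
transitivity (\sum_(e < n.+2) coefs2
  (varx ^+ e.*2 * gap_series e * (gap_series e.+1 - gap_series e)) n k) => //.
under eq_bigr do rewrite coefs2M.
rewrite exchange_big popularity21 natr_sum; apply: eq_bigr => i _.
rewrite [RHS]exchange_big natr_sum; apply: eq_bigr => a _ /=.
have le_in : (i <= n)%N by rewrite -ltnS.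
rewrite natr_sum (big_ord_widen n.+2 (fun e : nat =>
  (multichoose (i./2 - e) a.+1 * multichoose (uphalf i) a.+1 *
   (multichoose (n - i)./2 (k - a).+1 *
    multichoose (uphalf (n - i) + e).+1 (k - a)))%:R)); last by lia.
rewrite big_mkcond; apply: eq_bigr => -[e /= _] _.
rewrite /coefs2 coefs_fpsXnM.
have -> : (e < i./2.+1)%N = (e.*2 <= i)%N by lia.
case: ifP => [le_ei|_]; last by rewrite coefs0 mul0r.
rewrite natrM -pair_seriesB /= addnS.
by congr ((_ * _)%:R * _); congr (multichoose _ _); lia.
Qed.

(** The missing tail of the geometric series is divisible by [varx ^+ N]. *)
Lemma geometric_truncated (q f : fps2) N n : (n < N)%N ->
  1 - varx * q \is a GRing.unit ->
  coefs (\sum_(e < N) (varx * q) ^+ e * f) n = coefs (f / (1 - varx * q)) n.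
Proof.
move=> lt_nN qU; rewrite -mulr_suml; set s := \sum_(e < _) _.
have sE : s = (1 - (varx * q) ^+ N) / (1 - varx * q).
  apply: (mulIr qU); rewrite divrK // mulrC.
  by rewrite -[1 - varx * q]opprB mulNr -subrX1 opprB.
rewrite sE mulrAC mulrBl mul1r mulrBl coefsD coefsN exprMn -!mulrA coefs_fpsXnM.
by rewrite leqNgt lt_nN subr0 mulrC.
Qed.

(** The terms of the sum over [e] are geometric of ratio x^2 / c^2, and
    [2 * c - (1 - y + x ^+ 2)], the square root of the statement, is the difference
    c - x^2 / c of the roots. *)
Lemma popularity_gf21E (c : fps2) :
  c \is a GRing.unit -> c - varx \is a GRing.unit ->
  c ^+ 2 + varx ^+ 2 = (1 - vary + varx ^+ 2) * c ->
  popularity_gf P21 * (2 * c - (1 - vary + varx ^+ 2)) =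
  varx ^+ 2 * vary * gap_series 0 ^+ 2 * (1 - c).
Proof.
move=> cU cxU cE.
have qU : 1 - varx * (varx * c^-1 ^+ 2) \is a GRing.unit.
  by rewrite fps_unitE coefsD coefsN coefs_fpsXM subr0 unitr1.
have -> : popularity_gf P21 = varx ^+ 2 * vary *
    ((c^-1 - 1) * gap_series 0 ^+ 2 / (1 - varx * (varx * c^-1 ^+ 2))).
  apply: fpsP => n; rewrite popularity_gf21 !coefs_shift.
  case: leqP => // le2n; congr (_ * _).
  rewrite -(@geometric_truncated _ _ n) //; last by lia.
  congr (coefs _ _); apply: eq_bigr => e _.
  have -> : varx * (varx * c^-1 ^+ 2) = varx ^+ 2 * c^-1 ^+ 2 by ring.
  rewrite !(gap_seriesE cU cxU cE) exprMn -!exprM mul2n -addnn.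
  rewrite [c^-1 ^+ (e + e)]exprD exprS.
  by move: (varx ^+ _) (c^-1 ^+ e) => xe ce; ring.
have -> : 2 * c - (1 - vary + varx ^+ 2) =
    c * (1 - varx * (varx * c^-1 ^+ 2)).
  rewrite (kernelE cU cE).
  transitivity (c - varx ^+ 2 * (c * c^-1) * c^-1); last by ring.
  by rewrite mulrV //; ring.
move: (1 - varx * _) qU => q qU.
transitivity (varx ^+ 2 * vary * gap_series 0 ^+ 2
  * (c^-1 * c - c) * (q^-1 * q)); first by ring.
by rewrite !mulVr // mulr1.
Qed.

(** The coefficient of x^n on the right is that of y T_0 times [n.-1]; the last
    term corrects [n = 0], where [n.-1] is 0 and not -1. *)
Lemma popularity_gf_total :
  popularity_gf P11 + popularity_gf P21 + popularity_gf P12 =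
  euler (vary * gap_series 0) - vary * gap_series 0 + vary / (1 - vary).
Proof.
have geom : (1 - vary)^-1 = fpsC (pair_series 0 0).
  have ge : (1 - vary) * fpsC (pair_series 0 0) = 1.
    apply: fpsP => -[|n]; first by rewrite coefs_1ByM pair_series00.
    by rewrite coefs_1ByM /= mulr0.
  have yU : 1 - vary \is a GRing.unit.
    by apply/unitrPr; exists (fpsC (pair_series 0 0)).
  by apply: (mulrI yU); rewrite mulrV.
apply: fpsP => n; rewrite geom.
have -> :
    coefs (popularity_gf P11 + popularity_gf P21 + popularity_gf P12) n =
    (fpsX rat * coefs (gap_series 0) n) *+ n.-1.
  apply: fpsP => k; rewrite !coefsD.
  rewrite [RHS](_ : _ =
    coefs (fpsX rat * coefs (gap_series 0) n) k *+ n.-1); last first.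
    by elim: n.-1 => [|m IHm]; rewrite ?mulr0n ?coefs0 // !mulrS coefsD IHm.
  rewrite coefs_fpsXM; case: k => [|k] /=; first by rewrite !addr0 mul0rn.
  by rewrite -!natrD popularity_total addn0 mulnC natrM mulr_natr mulnC.
rewrite !coefsD coefsN coefs_euler !coefs_varyM.
case: n => [|n]; first by rewrite mulr0n add0r addNr.
by rewrite /= mulr0 addr0 mulrSr addrK.
Qed.

(** * The three generating functions *)

(** Here [t] and [c] stand for T_0 and the root c, [dt] and [dc] for their
    derivatives x d/dx, and [v] for 1 / (1 - y). *)
Lemma gf12_identity (R : comNzRingType) (x y c A t dt dc v g11 g21 g12 : R) :
  c ^+ 2 + x ^+ 2 = (1 - y + x ^+ 2) * c -> A = 2 * c - (1 - y + x ^+ 2) ->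
  t * (c - x) = 1 -> dt * (c - x) + t * (dc - x) = 0 ->
  A * dc = 2 * x ^+ 2 * (c - 1) -> (1 - y) * v = 1 ->
  g11 = x ^+ 2 * y * t ^+ 2 -> g21 * A = x ^+ 2 * y * t ^+ 2 * (1 - c) ->
  g11 + g21 + g12 = y * dt - y * t + y * v ->
  g12 * ((2 * (c - x)) ^+ 2 * (1 - y) * A) =
  2 * x * y * (x ^+ 5 - 2 * x ^+ 4 - x ^+ 3 * y - 3 * x ^+ 3 + 4 * x ^+ 2 * y
    + 4 * x ^+ 2 - 2 * x * y - 2 * y ^+ 2 + 2 * x + 4 * y - 2
    + (x ^+ 3 - 2 * x ^+ 2 + 2 * x * y - 2 * x - 2 * y + 2) * A).
Proof.
move=> cE AE tw dtE dcE vE g11E g21E total.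
have -> : g12 = y * dt - y * t + y * v - g11 - g21 by rewrite -total; ring.
have {}dtE : dt * (c - x) = - (t * (dc - x)).
  by apply/eqP; rewrite -addr_eq0 dtE.
have E0 : c ^+ 2 + x ^+ 2 - (1 - y + x ^+ 2) * c = 0 by rewrite cE subrr.
set w := c - x in tw dtE *.
(* Clearing denominators leaves each term with a factor that a hypothesis
   evaluates. *)
transitivity (4 * (1 - y) * y * (dt * w) * w * A
  - 4 * (1 - y) * y * (t * w) * w * A - 4 * (1 - y) * w ^+ 2 * g11 * A
  - 4 * (1 - y) * w ^+ 2 * (g21 * A) + 4 * w ^+ 2 * y * A * ((1 - y) * v)).
  by ring.
rewrite dtE g21E g11E vE tw.
transitivity (- (4 * (1 - y) * y * (t * w) * (A * dc - x * A))
  - 4 * (1 - y) * y * w * A - 4 * (1 - y) * x ^+ 2 * y * (t * w) ^+ 2 * A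
  - 4 * (1 - y) * x ^+ 2 * y * (1 - c) * (t * w) ^+ 2 + 4 * w ^+ 2 * y * A).
  by ring.
rewrite tw dcE AE /w; apply/eqP; rewrite -subr_eq0; apply/eqP.
(* The difference is cubic in c.  Dividing it by the quadratic equation of c
   gives this cofactor and remainder 0. *)
transitivity ((c ^+ 2 + x ^+ 2 - (1 - y + x ^+ 2) * c) *
              (8 * y * c + 4 * y * (y + x ^+ 2 - 4 * x - 1))); first by ring.
by rewrite E0 mul0r.
Qed.

Theorem corollary2p10 :
  let x := varx in
  let y := vary in
  let A1 := sqrt_fps2
    (x ^+ 4 - 2 * x ^+ 2 * y - 2 * x ^+ 2 + y ^+ 2 - 2 * y + 1) in
  let A3 := x ^+ 5 - 2 * x ^+ 4 - x ^+ 3 * y - 3 * x ^+ 3 + 4 * x ^+ 2 * y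
    + 4 * x ^+ 2 - 2 * x * y - 2 * y ^+ 2 + 2 * x + 4 * y - 2 in
  [/\ popularity_gf P11 =
        4 * x ^+ 2 * y / (1 - y - 2 * x + x ^+ 2 + A1) ^+ 2,
      popularity_gf P21 =
        2 * x ^+ 2 * y * (1 + y - x ^+ 2 - A1)
        / ((1 - y - 2 * x + x ^+ 2 + A1) ^+ 2 * A1)
    & popularity_gf P12 =
        2 * x * y
        * (A3 + (x ^+ 3 - 2 * x ^+ 2 + 2 * x * y - 2 * x - 2 * y + 2) * A1)
        / ((1 - y - 2 * x + x ^+ 2 + A1) ^+ 2 * (1 - y) * A1)].
Proof.
move=> x y A A3.
have x0 : coefs2 x 0 0 = 0 by [].
have y0 : coefs2 y 0 0 = 0 by [].
have c0D f g : coefs2 (f + g) 0 0 = coefs2 f 0 0 + coefs2 g 0 0 by [].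
have c0N f : coefs2 (- f) 0 0 = - coefs2 f 0 0 by [].
have c0M f g : coefs2 (f * g) 0 0 = coefs2 f 0 0 * coefs2 g 0 0.
  by rewrite /coefs2 !coefsM0.
have c01 : coefs2 1 0 0 = 1 by [].
pose c0E := (c0D, c0N, c0M, c01, x0, y0, exprS, expr0).
have [A2 A0] :
    A ^+ 2 = x ^+ 4 - 2 * x ^+ 2 * y - 2 * x ^+ 2 + y ^+ 2 - 2 * y + 1
    /\ coefs2 A 0 0 = 1.
  by apply: sqrt_fps2P; rewrite !c0E; ring.
have twoU : (2 : fps2) \is a GRing.unit by rewrite fps2_unitE c0D c01.
clearbody A.
have [c c2] : exists c, 2 * c = 1 - y + x ^+ 2 + A.
  by exists ((1 - y + x ^+ 2 + A) / 2); rewrite mulrC divrK.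
have c0 : coefs2 c 0 0 = 1.
  have := congr1 (fun f => coefs2 f 0 0) c2; rewrite /= !c0E A0 => c20.
  by apply: (@mulfI _ (1 + 1)) => //; rewrite c20; ring.
have cU : c \is a GRing.unit by rewrite fps2_unitE c0.
have cxU : c - x \is a GRing.unit by rewrite fps2_unitE !c0E c0.
have yU : 1 - y \is a GRing.unit by rewrite fps2_unitE !c0E.
have AU : A \is a GRing.unit by rewrite fps2_unitE A0.
have AE : A = 2 * c - (1 - y + x ^+ 2) by rewrite c2; ring.
have kerE : c ^+ 2 + x ^+ 2 = (1 - y + x ^+ 2) * c.
  apply/eqP; rewrite -subr_eq0; apply/eqP/(mulrI twoU)/(mulrI twoU).
  rewrite !mulr0 -[RHS](subrr (A ^+ 2)) {2}A2 AE; ring.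
set t := gap_series 0.
have tE : t * (c - x) = 1 by rewrite /t (gap_series0 cU cxU kerE) (mulVr cxU).
have gf11 : popularity_gf P11 = x ^+ 2 * y * t ^+ 2 := popularity_gf11.
have gf21 : popularity_gf P21 * A = x ^+ 2 * y * t ^+ 2 * (1 - c).
  by rewrite AE; exact: (popularity_gf21E cU cxU kerE).
have gfT := popularity_gf_total; rewrite gf11 -/x -/y -/t in gfT.
have ex : euler x = x by exact: euler_fpsX.
have ey : euler y = 0 by exact: euler_fpsC.
have dcE : A * euler c = 2 * x ^+ 2 * (c - 1).
  have := congr1 (@euler _) kerE.
  rewrite !expr2 !(eulerD, eulerM, eulerN, euler1, ex, ey) => /eqP.
  rewrite -subr_eq0 => /eqP e0.
  rewrite AE; apply/eqP; rewrite -subr_eq0; apply/eqP.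
  by rewrite -[RHS]e0; ring.
have dtE : euler t * (c - x) + t * (euler c - x) = 0.
  by have := congr1 (@euler _) tE; rewrite eulerM eulerD eulerN ex euler1.
have -> : 1 - y - 2 * x + x ^+ 2 + A = 2 * (c - x) by rewrite AE; ring.
have DU : 2 * (c - x) \is a GRing.unit by rewrite unitrM twoU cxU.
split.
- apply: (mulIr (unitrX 2 DU)); rewrite divrK ?unitrX // gf11.
  transitivity (4 * x ^+ 2 * y * (t * (c - x)) ^+ 2); first by ring.
  by rewrite tE; ring.
- have U : (2 * (c - x)) ^+ 2 * A \is a GRing.unit by rewrite unitrM unitrX.
  apply: (mulIr U); rewrite divrK // mulrCA gf21.
  transitivity (4 * x ^+ 2 * y * (1 - c) * (t * (c - x)) ^+ 2); first by ring.
  by rewrite tE AE; ring.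
have U : (2 * (c - x)) ^+ 2 * (1 - y) * A \is a GRing.unit.
  by rewrite unitrM AU unitrM yU unitrX.
apply: (mulIr U); rewrite divrK //.
apply: (gf12_identity kerE AE tE dtE dcE (mulrV yU) erefl gf21).
by rewrite gfT eulerM ey mul0r add0r.
Qed.
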